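(* Let $\varphi\in[0,1)$ be irrational, let $f:\mathbb{C}\to\mathbb{C}$ be a bounded function and let $\{y(n)\}_{n\ge 1}\subset\mathbb{C}$ be a bounded sequence. Suppose that the following conditions hold: 1. There exists a function $\Phi:[0,1)\to\mathbb{R}$ such that $$\sup_{\theta\in[0,1)}\left|\Phi(\theta)-\operatorname{Re}\left(\overline{f(\rho\, e(\theta))}\cdot e(\varphi+\theta)\right)\right|\to 0,\qquad \rho\to+\infty.$$ 2. $\Phi$ is Riemann integrable on $[0,1)$ or, equivalently, for Lebesgue almost all $\theta\in[0,1)$ we have $\lim_{\delta\to 0}\Phi(\theta+\delta)=\Phi(\theta)$. 3. There exist a constant $D_0\in\mathbb{N}$ and a real constant $\beta<0$ such that for all integers $n_2>n_1\ge 1$ with $n_2-n_1\ge D_0$ we have $$\frac{1}{n_2-n_1}\left|\sum_{n=n_1}^{n_2-1}y(n)e(-n\varphi)\right|+\int_{[0,1)}\Phi(s)\,ds\le\beta.$$ Then for any $x(1)\in\mathbb{C}$ the solution $\{x(n)\}_{n\ge 1}$ of the difference equation $$x(n+1)=e(\varphi)x(n)+f(x(n))+y(n),\qquad n\ge 1,$$ is bounded.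
   Context: For real $t$, $e(t):=e^{2\pi i t}$. Functions on $[0,1)$ are identified with their $1$-periodic extensions to $\mathbb{R}$ (equivalently, with functions on $\mathbb{T}=\mathbb{R}/\mathbb{Z}$), so that $\Phi(\theta+\delta)$ makes sense for all real $\delta$. *)

(* Defs.v *)
From Stdlib Require Import Reals QArith Qreals.
From Coquelicot Require Import Coquelicot.

Open Scope R_scope.

(* e(t) = exp (2 pi i t), given by its real and imaginary parts. *)
Definition e (t : R) : C := (cos (2 * PI * t), sin (2 * PI * t)).

Definition irrational (t : R) : Prop := forall q : Q, t <> Q2R q.

Definition periodic1 (g : R -> R) : Prop := forall t : R, g (t + 1) = g t.

Definition bounded_fun (f : C -> C) : Prop :=
  exists M : R, forall z : C, Cmod (f z) <= M.

(* Sequences are indexed by n >= 1; the entry at 0 is irrelevant. *)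
Definition bounded_seq (u : nat -> C) : Prop :=
  exists M : R, forall n : nat, (1 <= n)%nat -> Cmod (u n) <= M.

(* The supremum is taken in the extended reals, so that it always exists. *)
Definition sup_unit (g : R -> R) : Rbar :=
  Lub_Rbar (fun v : R => exists theta : R, 0 <= theta < 1 /\ v = g theta).

Definition radial_error (phi : R) (f : C -> C) (Phi : R -> R) (rho : R) : Rbar :=
  sup_unit (fun theta =>
    Rabs (Phi theta -
          Re (Cmult (Cconj (f (Cmult (RtoC rho) (e theta)))) (e (phi + theta))))).

(* Finiteness is needed because [real] sends infinite values to 0. *)
Definition radial_limit (phi : R) (f : C -> C) (Phi : R -> R) : Prop :=
  Rbar_locally p_infty (fun rho => is_finite (radial_error phi f Phi rho)) /\
  is_lim (fun rho => real (radial_error phi f Phi rho)) p_infty 0.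

Definition is_solution (phi : R) (f : C -> C) (y x : nat -> C) : Prop :=
  forall n : nat, (1 <= n)%nat ->
    x (S n) = Cplus (Cplus (Cmult (e phi) (x n)) (f (x n))) (y n).

(* Main.v *)
Require Import Defs.
From Stdlib Require Import Reals QArith Qreals.
From Stdlib Require Import ZArith List Permutation Lia Lra.
From Coquelicot Require Import Coquelicot.
Open Scope R_scope.

(** Put the solution in a rotating frame: [e(-n phi) x(n)] moves by bounded
    steps, so far from the origin its argument hardly changes during a block of
    [q] consecutive steps.  Let [alpha] be that argument at the start of the
    block, time 0.  The point [x(i)] then has argument [alpha + i phi + delta_i]
    with [delta_i] tiny, and since [|x(i)|] is large the forcing [f(x(i))]
    contributes about [Phi (alpha + i phi + delta_i)] to the radial motion,
    while the [y]-terms contribute at most [|sum y(n) e(-n phi)|].  The motion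
    orthogonal to the direction [alpha] changes the modulus only at second
    order.  Hence over one block the modulus grows by at most
    [sum Phi (alpha + i phi + delta_i) + |sum y(n) e(-n phi)| + error]
    ([block_drift]).

    If the first sum is at most [q (int Phi + eps)], the drift hypothesis makes
    this negative, so [|x(n + q)| <= |x(n)|] whenever [|x(n)|] is large, and
    bounded steps do the rest ([bounded_of_block_decrease]).

    The equidistribution needed is thus an upper bound, for one large [q],
    uniform in [alpha] and stable under perturbing the points
    ([rotation_average]).  It can be read off the definition of the Riemann
    integral.  Choose [p/q] in lowest terms with [|phi - p/q| <= 1/q^2].  The
    numbers [i p/q] run modulo 1 through all multiples of [1/q], and for
    [i < q] the corrections [i (phi - p/q)] all have the same sign and differ by
    at most [(q-1)/q^2 < 1/q].  So, modulo 1, the [q] points lie one in each of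
    [q] adjacent cells of length [1/q], with room [1/q^2] left for the
    [delta_i], and the average is a Riemann sum of mesh [1/q].  *)

(** * Rational approximation by Farey brackets *)

Lemma irrational_mult_ne (phi : R) (a b : Z) :
  irrational phi -> (0 < b)%Z -> IZR b * phi <> IZR a.
Proof.
  intros Hirr Hb Heq.
  apply (Hirr (Qmake a (Z.to_pos b))).
  unfold Q2R; simpl. rewrite Z2Pos.id by assumption.
  assert (IZR b <> 0) by (apply not_0_IZR; lia).
  rewrite <- Heq. field. assumption.
Qed.

(** The determinant condition says that [a/b < c/d] are Farey neighbours; it
    gives their distance [1/(bd)], and it exhibits the inverse of [a] modulo [b]
    and of [c] modulo [d].  Strict inequalities are multiplied out to avoid
    quotients. *)
Definition farey_bracket (phi : R) (a b c d : Z) : Prop :=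
  (0 < b)%Z /\ (0 < d)%Z /\ (c * b - a * d = 1)%Z /\
  IZR a < IZR b * phi /\ IZR d * phi < IZR c.

(** This symmetry lets statements on the left end serve for the right end. *)
Lemma farey_bracket_opp (phi : R) (a b c d : Z) :
  farey_bracket phi a b c d -> farey_bracket (- phi) (- c) d (- a) b.
Proof.
  intros (Hb & Hd & Hdet & Ha & Hc).
  repeat split; try assumption; try lia; rewrite ?opp_IZR; lra.
Qed.

(** Repeated mediants with [a/b] push the right end [(ka + c)/(kb + d)] down to
    [a/b < phi].  The first mediant that falls below [phi] becomes the new left
    end. *)
Lemma farey_raise_left (phi : R) (a b c d : Z) :
  irrational phi -> farey_bracket phi a b c d ->
  exists a' b' c' d' : Z,
    farey_bracket phi a' b' c' d' /\ (b < b')%Z /\ (d <= d')%Z.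
Proof.
  intros Hirr (Hb & Hd & Hdet & Ha & Hc).
  assert (Hk : forall k : nat,
    (exists a' b' c' d' : Z,
      farey_bracket phi a' b' c' d' /\ (b < b')%Z /\ (d <= d')%Z) \/
    farey_bracket phi a b (Z.of_nat k * a + c) (Z.of_nat k * b + d)).
  { induction k as [|k IHk].
    - right. repeat split; try assumption; try lia; simpl; assumption.
    - destruct IHk as [IHk | (_ & Hd' & Hdet' & _ & Hc')]; [left; exact IHk|].
      destruct (Rtotal_order (IZR (Z.of_nat (S k) * b + d) * phi)
                             (IZR (Z.of_nat (S k) * a + c))) as [H | [H | H]].
      + right. repeat split; try assumption; nia.
      + exfalso. revert H. apply irrational_mult_ne; [assumption | nia].
      + left.
        exists (Z.of_nat (S k) * a + c)%Z, (Z.of_nat (S k) * b + d)%Z,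
          (Z.of_nat k * a + c)%Z, (Z.of_nat k * b + d)%Z.
        repeat split; try assumption; nia. }
  (* The mediant is above [phi] iff [k (b phi - a) < c - d phi], which fails for
     large [k]; the [+ 1] makes the bound strict. *)
  destruct (archimed_cor1 ((IZR b * phi - IZR a) / (Rabs (IZR c - IZR d * phi) + 1)))
    as [k [Hk1 Hk0]].
  { apply Rdiv_lt_0_compat; [lra|]. pose proof (Rabs_pos (IZR c - IZR d * phi)). lra. }
  destruct (Hk k) as [H | (_ & _ & _ & _ & H)]; [exact H|].
  exfalso. rewrite !plus_IZR, !mult_IZR, <- INR_IZR_INZ in H.
  rewrite Rabs_right in Hk1 by lra.
  assert (Hk' : 0 < INR k) by (apply lt_0_INR; lia).
  set (u := IZR b * phi - IZR a) in *. set (v := IZR c - IZR d * phi) in *.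
  assert (Hv : 0 < v) by (unfold v; lra).
  assert (INR k * u < v) by (unfold u, v; nra).
  assert (1 < INR k * (u / (v + 1))).
  { apply Rmult_lt_compat_l with (r := INR k) in Hk1; [|assumption].
    rewrite Rinv_r in Hk1 by lra. exact Hk1. }
  assert (INR k * (u / (v + 1)) * (v + 1) = INR k * u) by (field; lra).
  nra.
Qed.

Lemma farey_brackets_unbounded (phi : R) (N : nat) :
  0 <= phi < 1 -> irrational phi ->
  exists a b c d : Z, farey_bracket phi a b c d /\
    (Z.of_nat N <= b)%Z /\ (Z.of_nat N <= d)%Z.
Proof.
  intros Hphi Hirr. induction N as [|N IHN].
  - exists 0%Z, 1%Z, 1%Z, 1%Z. repeat split; try lia; simpl; [|lra].
    pose proof (irrational_mult_ne phi 0 1 Hirr). simpl in *.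
    destruct Hphi as [[H0|H0] _]; [lra|]. exfalso. apply H; [lia|lra].
  - destruct IHN as (a & b & c & d & Hbr & Hb & Hd).
    destruct (farey_raise_left phi a b c d Hirr Hbr)
      as (a1 & b1 & c1 & d1 & Hbr1 & Hb1 & Hd1).
    destruct (farey_raise_left (- phi) (- c1) d1 (- a1) b1)
      as (c2 & d2 & a2 & b2 & Hbr2 & Hd2 & Hb2).
    + intros r Hr. apply (Hirr (- r)%Q). rewrite Q2R_opp. lra.
    + apply farey_bracket_opp. assumption.
    + exists (- a2)%Z, b2, (- c2)%Z, d2. split; [|lia].
      rewrite <- (Ropp_involutive phi). apply farey_bracket_opp. assumption.
Qed.

(** The end of a bracket with the smaller denominator [q] is within
    [1/(bd) <= 1/q^2] of [phi].  The inverse [p'] of [p] modulo [q] is recorded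
    in place of coprimality, because it is used to solve congruences. *)
Lemma rational_approximation (phi : R) (N : nat) :
  0 <= phi < 1 -> irrational phi ->
  exists (q : nat) (p p' m : Z),
    (N <= q)%nat /\ (0 < q)%nat /\ (p * p' = 1 + Z.of_nat q * m)%Z /\
    Rabs (phi - IZR p / INR q) <= / (INR q * INR q).
Proof.
  intros Hphi Hirr.
  destruct (farey_brackets_unbounded phi N Hphi Hirr)
    as (a & b & c & d & (Hb & Hd & Hdet & Ha & Hc) & HbN & HdN).
  assert (Hdet' : IZR c * IZR b - IZR a * IZR d = 1)
    by (rewrite <- !mult_IZR, <- minus_IZR, Hdet; reflexivity).
  assert (Hb' : 0 < IZR b) by (apply IZR_lt; assumption).
  assert (Hd' : 0 < IZR d) by (apply IZR_lt; assumption).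
  destruct (Z_le_gt_dec b d) as [Hbd | Hbd].
  - exists (Z.to_nat b), a, (- d)%Z, (- c)%Z.
    rewrite INR_IZR_INZ, Z2Nat.id by lia.
    repeat split; try lia.
    assert (IZR b <= IZR d) by (apply IZR_le; assumption).
    replace (phi - IZR a / IZR b) with ((IZR b * phi - IZR a) * / IZR b)
      by (field; lra).
    rewrite Rinv_mult, Rabs_mult, (Rabs_right (/ IZR b))
      by (apply Rle_ge, Rlt_le, Rinv_0_lt_compat; assumption).
    apply Rmult_le_compat_r; [apply Rlt_le, Rinv_0_lt_compat; assumption|].
    rewrite Rabs_right by lra.
    apply Rmult_le_reg_l with (IZR b); [assumption|]. rewrite Rinv_r by lra.
    assert (IZR d * (IZR b * phi - IZR a) < 1) by nra. nra.
  - exists (Z.to_nat d), c, b, a.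
    rewrite INR_IZR_INZ, Z2Nat.id by lia.
    repeat split; try lia.
    assert (IZR d <= IZR b) by (apply IZR_le; lia).
    replace (phi - IZR c / IZR d) with ((IZR d * phi - IZR c) * / IZR d)
      by (field; lra).
    rewrite Rinv_mult, Rabs_mult, (Rabs_right (/ IZR d))
      by (apply Rle_ge, Rlt_le, Rinv_0_lt_compat; assumption).
    apply Rmult_le_compat_r; [apply Rlt_le, Rinv_0_lt_compat; assumption|].
    rewrite Rabs_left by lra.
    apply Rmult_le_reg_l with (IZR d); [assumption|]. rewrite Rinv_r by lra.
    assert (IZR b * (IZR c - IZR d * phi) < 1) by nra. nra.
Qed.

(** * Permuted finite sums *)

(** Indexing by a list makes reordering a [Permutation] of the indices. *)
Definition Rsum (g : nat -> R) (l : list nat) : R := fold_right Rplus 0 (map g l).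

Lemma Rsum_Permutation (g : nat -> R) (l l' : list nat) :
  Permutation l l' -> Rsum g l = Rsum g l'.
Proof. unfold Rsum. induction 1; simpl; lra. Qed.

Lemma Rsum_app (g : nat -> R) (l l' : list nat) :
  Rsum g (l ++ l') = Rsum g l + Rsum g l'.
Proof. unfold Rsum. induction l; simpl; lra. Qed.

Lemma Rsum_seq_S (g : nat -> R) (n : nat) :
  Rsum g (seq 0 (S n)) = Rsum g (seq 0 n) + g n.
Proof. rewrite seq_S, Rsum_app. unfold Rsum; simpl. lra. Qed.

Lemma Rsum_map (g : nat -> R) (h : nat -> nat) (l : list nat) :
  Rsum g (map h l) = Rsum (fun k => g (h k)) l.
Proof. unfold Rsum. rewrite map_map. reflexivity. Qed.

Lemma Rsum_ext (g h : nat -> R) (l : list nat) :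
  (forall n, In n l -> g n = h n) -> Rsum g l = Rsum h l.
Proof. intros H. unfold Rsum. rewrite (map_ext_in _ _ _ H). reflexivity. Qed.

(** [tau k] is the solution [n] of [n p + j = k] modulo [q], that is
    [(k - j) p'] reduced modulo [q]. *)
Lemma affine_residue_permutation (q : nat) (p p' m j : Z) :
  (0 < q)%nat -> (p * p' = 1 + Z.of_nat q * m)%Z ->
  exists (tau : nat -> nat) (c : nat -> Z),
    Permutation (map tau (seq 0 q)) (seq 0 q) /\
    forall k, (Z.of_nat (tau k) * p + j = Z.of_nat k + c k * Z.of_nat q)%Z.
Proof.
  intros Hq Hinv.
  set (tau := fun k : nat => Z.to_nat (((Z.of_nat k - j) * p') mod Z.of_nat q)).
  set (c := fun k : nat =>
    ((Z.of_nat k - j) * m - (Z.of_nat k - j) * p' / Z.of_nat q * p)%Z).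
  assert (Htau : forall k,
      (Z.of_nat (tau k) * p + j = Z.of_nat k + c k * Z.of_nat q)%Z).
  { intros k. unfold tau, c.
    rewrite Z2Nat.id by (apply Z.mod_pos_bound; lia).
    rewrite Z.mod_eq by lia.
    set (t := ((Z.of_nat k - j) * p' / Z.of_nat q)%Z).
    replace (((Z.of_nat k - j) * p' - Z.of_nat q * t) * p)%Z
      with ((Z.of_nat k - j) * (p * p') - Z.of_nat q * t * p)%Z by ring.
    rewrite Hinv. ring. }
  exists tau, c. split; [|exact Htau].
  apply NoDup_Permutation_bis.
  - apply NoDup_map_NoDup_ForallPairs; [|apply seq_NoDup].
    intros k l Hk Hl Heq. apply in_seq in Hk, Hl.
    pose proof (Htau k) as Hck. pose proof (Htau l) as Hcl.
    rewrite Heq in Hck.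
    assert (Hd : (Z.of_nat k - Z.of_nat l = (c l - c k) * Z.of_nat q)%Z) by lia.
    assert (c l - c k = 0)%Z by nia. nia.
  - rewrite length_map. reflexivity.
  - intros n Hn. apply in_map_iff in Hn. destruct Hn as [k [<- _]].
    apply in_seq. unfold tau.
    pose proof (Z.mod_pos_bound ((Z.of_nat k - j) * p') (Z.of_nat q)). lia.
Qed.

(** * Riemann sums on translated uniform cells *)
Lemma pointed_subdiv_cons (h : R * R) (s : SF_seq) :
  fst h <= snd h <= SF_h s -> pointed_subdiv s -> pointed_subdiv (SF_cons h s).
Proof.
  intros Hh Hs [|i] Hi.
  - exact Hh.
  - apply (Hs i). unfold SF_size in *. simpl in Hi. lia.
Qed.

(** The pointed subdivision [x, x + h, ..., x + n h, 1], whose last cell is what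
    remains up to [1] and is tagged by its right end. *)
Fixpoint equal_cells (h x : R) (s : nat -> R) (n : nat) : SF_seq :=
  match n with
  | O => SF_cons (x, 1) (SF_nil 1)
  | S m => SF_cons (x, s O) (equal_cells h (x + h) (fun k => s (S k)) m)
  end.

Lemma equal_cells_start (h x : R) (s : nat -> R) (n : nat) :
  SF_h (equal_cells h x s n) = x.
Proof. destruct n; reflexivity. Qed.

Lemma SF_last_cons (h : R * R) (s : SF_seq) (d : R) :
  seq.last d (SF_lx (SF_cons h s)) = seq.last (SF_h s) (SF_lx s).
Proof. reflexivity. Qed.

Lemma equal_cells_end (h x d : R) (s : nat -> R) (n : nat) :
  seq.last d (SF_lx (equal_cells h x s n)) = 1.
Proof.
  revert x s d. induction n as [|n IHn]; intros x s d; [reflexivity|].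
  simpl equal_cells. rewrite SF_last_cons. apply IHn.
Qed.

Lemma seq_step_cons (h : R * R) (s : SF_seq) :
  seq_step (SF_lx (SF_cons h s)) = Rmax (Rabs (SF_h s - fst h)) (seq_step (SF_lx s)).
Proof. reflexivity. Qed.

Lemma equal_cells_step (h x : R) (s : nat -> R) (n : nat) :
  0 <= h -> 0 <= 1 - (x + INR n * h) <= h ->
  seq_step (SF_lx (equal_cells h x s n)) <= h.
Proof.
  intros Hh. revert x s. induction n as [|n IHn]; intros x s Hx.
  - simpl in *. unfold seq_step; simpl. apply Rmax_lub; [|assumption].
    rewrite Rabs_right; lra.
  - rewrite S_INR in Hx. simpl equal_cells. rewrite seq_step_cons, equal_cells_start.
    apply Rmax_lub; [simpl; rewrite Rabs_right; lra|]. apply IHn. lra.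
Qed.

Lemma equal_cells_pointed (h x : R) (s : nat -> R) (n : nat) :
  x + INR n * h <= 1 ->
  (forall k, (k < n)%nat -> x + INR k * h <= s k <= x + INR (S k) * h) ->
  pointed_subdiv (equal_cells h x s n).
Proof.
  revert x s. induction n as [|n IHn]; intros x s Hx Hs.
  - simpl in *. apply pointed_subdiv_cons; [simpl; lra|].
    intros i Hi. unfold SF_size in Hi; simpl in Hi; lia.
  - simpl equal_cells. apply pointed_subdiv_cons.
    + rewrite equal_cells_start. specialize (Hs O ltac:(lia)). simpl in *; lra.
    + apply IHn.
      * rewrite S_INR in Hx. lra.
      * intros k Hk. specialize (Hs (S k) ltac:(lia)).
        rewrite !S_INR in *. lra.
Qed.

Lemma equal_cells_Riemann_sum (Phi : R -> R) (h x : R) (s : nat -> R) (n : nat) :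
  Riemann_sum Phi (equal_cells h x s n) =
  h * Rsum (fun k => Phi (s k)) (seq 0 n) + (1 - (x + INR n * h)) * Phi 1.
Proof.
  revert x s. induction n as [|n IHn]; intros x s.
  - simpl equal_cells. rewrite Riemann_sum_cons.
    unfold Riemann_sum, Rsum; simpl. unfold plus, scal, zero; simpl.
    unfold mult; simpl. lra.
  - simpl equal_cells. rewrite Riemann_sum_cons, IHn, equal_cells_start.
    simpl seq. rewrite <- seq_shift.
    unfold Rsum at 2. simpl map. simpl fold_right.
    fold (Rsum (fun k => Phi (s k)) (map S (seq 0 n))). rewrite Rsum_map.
    rewrite S_INR. unfold plus, scal; simpl. unfold mult; simpl. lra.
Qed.


Lemma periodic1_nat (Phi : R -> R) (n : nat) (t : R) :
  periodic1 Phi -> Phi (t + INR n) = Phi t.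
Proof.
  intros Hper. induction n as [|n IHn].
  - simpl. f_equal. lra.
  - rewrite S_INR, <- Rplus_assoc, Hper. exact IHn.
Qed.

Lemma periodic1_Z (Phi : R -> R) (z : Z) (t : R) :
  periodic1 Phi -> Phi (t + IZR z) = Phi t.
Proof.
  intros Hper. destruct (Z_le_gt_dec 0 z) as [Hz | Hz].
  - rewrite <- (Z2Nat.id z Hz), <- INR_IZR_INZ. apply periodic1_nat, Hper.
  - rewrite <- (periodic1_nat Phi (Z.to_nat (- z)) (t + IZR z) Hper).
    f_equal. rewrite INR_IZR_INZ, Z2Nat.id by lia. rewrite opp_IZR. lra.
Qed.

Lemma floor_exists (t : R) : exists z : Z, 0 <= t - IZR z < 1.
Proof. exists (Int_part t). pose proof (base_Int_part t). lra. Qed.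

Lemma periodic1_bounded (Phi : R -> R) :
  periodic1 Phi -> ex_RInt Phi 0 1 -> exists B, forall t, Rabs (Phi t) <= B.
Proof.
  intros Hper Hint. destruct (ex_RInt_ub Phi 0 1 Hint) as [B HB].
  rewrite Rmin_left, Rmax_right in HB by lra.
  exists B. intros t. destruct (floor_exists t) as [z Hz].
  rewrite <- (periodic1_Z Phi (- z) t Hper). apply HB. rewrite opp_IZR. lra.
Qed.

Lemma Riemann_sum_limit (Phi : R -> R) (eps : R) :
  ex_RInt Phi 0 1 -> 0 < eps -> exists delta, 0 < delta /\
  forall ptd : SF_seq, pointed_subdiv ptd -> SF_h ptd = 0 ->
    seq.last (SF_h ptd) (SF_lx ptd) = 1 -> seq_step (SF_lx ptd) < delta ->
    Rabs (Riemann_sum Phi ptd - RInt Phi 0 1) < eps.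
Proof.
  intros Hint Heps.
  pose proof (RInt_correct Phi 0 1 Hint) as HI. unfold is_RInt in HI.
  destruct (proj1 (filterlim_locally (F := Riemann_fine 0 1) _ _) HI
    (mkposreal eps Heps)) as [delta Hdelta].
  exists delta. split; [apply cond_pos|].
  intros ptd Hptd H0 H1 Hstep.
  specialize (Hdelta ptd Hstep).
  rewrite Rmin_left, Rmax_right, Rminus_0_r, sign_eq_1 in Hdelta by lra.
  rewrite <- (Rmult_1_l (Riemann_sum Phi ptd)).
  apply Hdelta. auto.
Qed.

(** The cells tile [[a, a + 1]] while the integral is over [[0, 1]].  All but the
    last cell lie in [[0, 1]]; the two gaps at the ends have total length
    [1/q], like the last cell, so trading it for them costs [O(1/q)] as [Phi] is
    bounded.  Thus the threshold [q0] does not depend on [a]. *)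
Lemma Riemann_sum_shifted_cells (Phi : R -> R) (eps : R) :
  periodic1 Phi -> ex_RInt Phi 0 1 -> 0 < eps ->
  exists q0 : nat, forall q : nat, (q0 <= q)%nat -> (0 < q)%nat ->
  forall (a : R) (s : nat -> R), 0 <= a <= / INR q ->
  (forall k, (k < q)%nat -> a + INR k * / INR q <= s k <= a + INR (S k) * / INR q) ->
  Rsum (fun k => Phi (s k)) (seq 0 q) <= INR q * (RInt Phi 0 1 + eps).
Proof.
  intros Hper Hint Heps.
  destruct (periodic1_bounded Phi Hper Hint) as [B HB].
  assert (HB0 : 0 <= B) by (specialize (HB 0); pose proof (Rabs_pos (Phi 0)); lra).
  destruct (Riemann_sum_limit Phi (eps / 2) Hint) as [delta [Hdelta Hlim]]; [lra|].
  destruct (archimed_cor1 delta Hdelta) as [q1 [Hq1 Hq1pos]].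
  (* Beyond [4 B / eps] the exchanged cell costs [2 B / q <= eps / 2]. *)
  destruct (nfloor_ex (4 * B / eps)) as [q2 Hq2].
  { apply Rdiv_le_0_compat; lra. }
  exists (q1 + S q2)%nat. intros q Hq Hqpos a s Ha Hs.
  destruct q as [|n]; [lia|]. clear Hqpos.
  set (h := / INR (S n)) in *.
  assert (HSn : 0 < INR (S n)) by (apply lt_0_INR; lia).
  assert (Hh : 0 < h) by (apply Rinv_0_lt_compat; assumption).
  assert (Hnh : INR n * h + h = 1).
  { unfold h. rewrite S_INR in *. field. lra. }
  set (ptd := SF_cons (0, 0) (equal_cells h a s n)).
  assert (Hsum : Riemann_sum Phi ptd
      = h * Rsum (fun k => Phi (s k)) (seq 0 n) + h * Phi 0).
  { unfold ptd. rewrite Riemann_sum_cons, equal_cells_Riemann_sum, equal_cells_start.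
    (* The end gaps are tagged by [0] and [1], where [Phi] agrees, so they combine
       into one term that does not depend on [a]. *)
    replace (Phi 1) with (Phi 0) by (rewrite <- (Hper 0); f_equal; lra).
    unfold plus, scal; simpl; unfold mult; simpl.
    replace (1 - (a + INR n * h)) with (h - a) by lra. ring. }
  assert (Hclose : Rabs (Riemann_sum Phi ptd - RInt Phi 0 1) < eps / 2).
  { apply Hlim; unfold ptd.
    - apply pointed_subdiv_cons; [rewrite equal_cells_start; simpl; lra|].
      apply equal_cells_pointed; [lra|].
      intros k Hk. apply Hs. lia.
    - reflexivity.
    - rewrite SF_last_cons. apply equal_cells_end.
    - rewrite seq_step_cons, equal_cells_start. apply Rle_lt_trans with h.
      + apply Rmax_lub; [simpl; rewrite Rabs_right; lra|].
        apply equal_cells_step; lra.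
      + apply Rle_lt_trans with (/ INR q1); [|assumption].
        apply Rinv_le_contravar; [apply lt_0_INR; lia | apply le_INR; lia]. }
  rewrite Hsum in Hclose. apply Rabs_def2 in Hclose. destruct Hclose as [Hclose _].
  rewrite Rsum_seq_S.
  pose proof (proj1 (Rabs_le_between _ _) (HB (s n))) as HBs.
  pose proof (proj1 (Rabs_le_between _ _) (HB 0)) as HB1.
  assert (H4B : 4 * B <= INR (S n) * eps).
  { assert (INR q2 + 1 <= INR (S n)) by (rewrite <- S_INR; apply le_INR; lia).
    assert (4 * B = 4 * B / eps * eps) by (field; lra). nra. }
  assert (HH : INR (S n) * h = 1) by (unfold h; field; lra).
  set (X := Rsum (fun k => Phi (s k)) (seq 0 n)) in *.
  apply Rmult_lt_compat_l with (r := INR (S n)) in Hclose; [|assumption].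
  replace (INR (S n) * (h * X + h * Phi 0 - RInt Phi 0 1))
    with (INR (S n) * h * (X + Phi 0) - INR (S n) * RInt Phi 0 1) in Hclose by ring.
  rewrite HH in Hclose. lra.
Qed.
(** * Averages along perturbed orbits of the rotation *)

(** Uniform upper equidistribution for a single block length: up to a permutation
    and integer translations, the perturbed orbit has exactly one point in each of
    [q] adjacent cells of length [1/q]. *)
Lemma rotation_average (phi : R) (Phi : R -> R) (eps : R) (N : nat) :
  0 <= phi < 1 -> irrational phi -> periodic1 Phi -> ex_RInt Phi 0 1 -> 0 < eps ->
  exists q : nat, (N <= q)%nat /\ (0 < q)%nat /\ exists eta : R, 0 < eta /\
  forall (theta : R) (delta : nat -> R),
    (forall n, (n < q)%nat -> Rabs (delta n) <= eta) ->
    Rsum (fun n => Phi (theta + INR n * phi + delta n)) (seq 0 q)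
      <= INR q * (RInt Phi 0 1 + eps).
Proof.
  intros Hphi Hirr Hper Hint Heps.
  destruct (Riemann_sum_shifted_cells Phi eps Hper Hint Heps) as [q0 Hq0].
  destruct (rational_approximation phi (N + q0) Hphi Hirr)
    as (q & p & p' & m & HqN & Hq & Hinv & Happ).
  exists q. split; [lia|]. split; [assumption|].
  assert (HqR : 0 < INR q) by (apply lt_0_INR; assumption).
  set (h := / INR q) in *.
  assert (Hh : 0 < h) by (apply Rinv_0_lt_compat; assumption).
  assert (Hqh : INR q * h = 1) by (unfold h; field; lra).
  (* The corrections occupy an interval of length [h - h * h], which leaves a
     margin [h * h / 2] on each side of the cell. *)
  exists (h * h / 2). split; [nra|].
  intros theta delta Hdelta.
  rewrite Rinv_mult in Happ. fold h in Happ.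
  set (d := phi - IZR p / INR q) in *.
  assert (Hphid : phi = IZR p * h + d) by (unfold d, h; field; lra).
  apply Rabs_le_between in Happ.
  set (lo := Rmin 0 ((INR q - 1) * d)).
  assert (Hlo : forall n, (n < q)%nat -> 0 <= INR n * d - lo <= h - h * h).
  { intros n Hn.
    assert (Hn0 : 0 <= INR n) by apply pos_INR.
    assert (Hn1 : INR n <= INR q - 1).
    { assert (INR (S n) <= INR q) by (apply le_INR; lia). rewrite S_INR in *. lra. }
    assert (Hmesh : (INR q - 1) * (h * h) = h - h * h)
      by (replace ((INR q - 1) * (h * h)) with (INR q * h * h - h * h) by ring;
          rewrite Hqh; ring).
    unfold lo. destruct (Rle_dec 0 d).
    - rewrite Rmin_left by nra. nra.
    - rewrite Rmin_right by nra. nra. }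
  (* Move the left end of the first cell into [[0, h]] by a multiple [j] of [h];
     the permutation of residues absorbs [j]. *)
  destruct (floor_exists (INR q * (theta + lo - h * h / 2))) as [j Hj].
  set (a := theta + lo - h * h / 2 - IZR j * h).
  assert (Ha : 0 <= a <= h).
  { assert (Hqa : 0 <= INR q * a < 1).
    { unfold a. rewrite Rmult_minus_distr_l.
      replace (INR q * (IZR j * h)) with (IZR j * (INR q * h)) by ring.
      rewrite Hqh. lra. }
    split; nra. }
  destruct (affine_residue_permutation q p p' m j Hq Hinv) as (tau & c & Hperm & Htau).
  rewrite <- (Rsum_Permutation _ _ _ Hperm), Rsum_map.
  rewrite (Rsum_ext _ (fun k =>
    Phi (theta + INR (tau k) * phi + delta (tau k) + IZR (- c k)))).
  2:{ intros k _. rewrite periodic1_Z by assumption. reflexivity. }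
  apply (Hq0 q ltac:(lia) Hq a
    (fun k => theta + INR (tau k) * phi + delta (tau k) + IZR (- c k)) Ha).
  intros k Hk. fold h.
  assert (Htk : (tau k < q)%nat).
  { assert (H : In (tau k) (seq 0 q)).
    { apply (Permutation_in _ Hperm), in_map, in_seq. lia. }
    apply in_seq in H. lia. }
  specialize (Htau k). apply (f_equal IZR) in Htau.
  rewrite !plus_IZR, !mult_IZR, <- !INR_IZR_INZ in Htau.
  specialize (Hlo _ Htk). specialize (Hdelta _ Htk).
  apply Rabs_le_between in Hdelta.
  rewrite opp_IZR, S_INR.
  assert (Hpos : theta + INR (tau k) * phi + delta (tau k) + - IZR (c k)
    = a + INR k * h + (INR (tau k) * d - lo) + (delta (tau k) + h * h / 2)).
  { unfold a. rewrite Hphid.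
    assert (Hpc : (INR (tau k) * IZR p + IZR j) * h = INR k * h + IZR (c k)).
    { rewrite Htau, Rmult_plus_distr_r, Rmult_assoc, Hqh. ring. }
    lra. }
  rewrite Hpos. lra.
Qed.
(** * The exponential and polar coordinates *)
Lemma e_plus (s t : R) : e (s + t) = Cmult (e s) (e t).
Proof.
  unfold e, Cmult; simpl. rewrite Rmult_plus_distr_l, cos_plus, sin_plus.
  f_equal; ring.
Qed.

Lemma e_0 : e 0 = RtoC 1.
Proof. unfold e, RtoC. rewrite Rmult_0_r, cos_0, sin_0. reflexivity. Qed.

Lemma e_opp (t : R) : e (- t) = Cconj (e t).
Proof.
  unfold e, Cconj; simpl. rewrite <- cos_neg, <- sin_neg.
  replace (- (2 * PI * - t)) with (2 * PI * t) by ring.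
  replace (- (2 * PI * t)) with (2 * PI * - t) by ring. reflexivity.
Qed.

Lemma e_opp_mult (t : R) : Cmult (e (- t)) (e t) = RtoC 1.
Proof. rewrite <- e_plus, Rplus_opp_l. apply e_0. Qed.

Lemma Cmod_e (t : R) : Cmod (e t) = 1.
Proof.
  unfold Cmod, e; simpl fst; simpl snd. rewrite <- sqrt_1. f_equal.
  pose proof (sin2_cos2 (2 * PI * t)) as H. unfold Rsqr in H. lra.
Qed.

Lemma e_Z (t : R) (z : Z) : e (t + IZR z) = e t.
Proof.
  unfold e. f_equal.
  - apply (periodic1_Z (fun t => cos (2 * PI * t))).
    intros u. simpl. rewrite Rmult_plus_distr_l, Rmult_1_r, cos_plus, cos_2PI, sin_2PI. ring.
  - apply (periodic1_Z (fun t => sin (2 * PI * t))).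
    intros u. simpl. rewrite Rmult_plus_distr_l, Rmult_1_r, sin_plus, cos_2PI, sin_2PI. ring.
Qed.

Lemma Cmod_sq (z : C) : Cmod z * Cmod z = Re z * Re z + Im z * Im z.
Proof. pose proof (Cmod2_alt z). nra. Qed.

Lemma Re_le_Cmod (z : C) : Re z <= Cmod z.
Proof. apply Rle_trans with (2 := re_le_Cmod z). apply Rle_abs. Qed.

Lemma Im_le_Cmod (z : C) : Rabs (Im z) <= Cmod z.
Proof.
  pose proof (Cmod_sq z). pose proof (Cmod_ge_0 z).
  apply Rabs_le. split; nra.
Qed.

(** Transverse displacement affects the modulus only at second order. *)
Lemma Cmod_le_Re_plus (z : C) : 0 < Re z ->
  Cmod z <= Re z + Im z * Im z / (2 * Re z).
Proof.
  intros Ha. pose proof (Cmod_sq z) as Hz. pose proof (Cmod_ge_0 z).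
  set (t := Im z * Im z / (2 * Re z)).
  assert (Ht : 2 * Re z * t = Im z * Im z) by (unfold t; field; lra).
  assert (0 <= t) by (apply Rdiv_le_0_compat; nra).
  apply Rsqr_incr_0_var; unfold Rsqr; nra.
Qed.

Lemma polar_form (z : C) : exists t : R, z = Cmult (RtoC (Cmod z)) (e t).
Proof.
  destruct (Req_dec (Cmod z) 0) as [H0 | H0].
  { exists 0. apply Cmod_eq_0 in H0. rewrite H0, Cmod_0. ring. }
  pose proof (Cmod_ge_0 z) as Hr. pose proof (Cmod_sq z) as Hz.
  set (r := Cmod z) in *. set (a := Re z) in *. set (b := Im z) in *.
  assert (Hra : -1 <= a / r <= 1).
  { split.
    - apply Rle_div_r; nra.
    - apply Rle_div_l; nra. }
  assert (Hcos : cos (acos (a / r)) = a / r) by (apply cos_acos; assumption).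
  assert (Hsin : sin (acos (a / r)) = Rabs b / r).
  { rewrite sin_acos by assumption.
    replace (1 - (a / r)²) with ((Rabs b / r)²).
    - apply sqrt_Rsqr. apply Rdiv_le_0_compat; [apply Rabs_pos | lra].
    - rewrite !Rsqr_div', <- Rsqr_abs. unfold Rsqr.
      replace (b * b) with (r * r - a * a) by lra. field. assumption. }
  assert (HPI : 2 * PI <> 0) by (pose proof PI_RGT_0; lra).
  assert (Hzab : z = (a, b)) by (destruct z; reflexivity).
  rewrite Hzab. unfold e, Cmult, RtoC; simpl.
  destruct (Rle_dec 0 b) as [Hb | Hb].
  - exists (acos (a / r) / (2 * PI)).
    replace (2 * PI * (acos (a / r) / (2 * PI))) with (acos (a / r)) by (field; lra).
    rewrite Hcos, Hsin, Rabs_right by lra. f_equal; field; assumption.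
  - exists (- (acos (a / r) / (2 * PI))).
    replace (2 * PI * - (acos (a / r) / (2 * PI))) with (- acos (a / r)) by (field; lra).
    rewrite cos_neg, sin_neg, Hcos, Hsin, Rabs_left by lra. f_equal; field; assumption.
Qed.

(** The argument, in full turns, on the right half plane.  An explicit formula
    gives the sequence of angles [delta_i] of a block without choice, and a bound
    by the slope. *)
Definition turn (v : C) : R := atan (Im v / Re v) / (2 * PI).

Lemma turn_polar (v : C) : 0 < Re v -> v = Cmult (RtoC (Cmod v)) (e (turn v)).
Proof.
  intros Ha. pose proof PI_RGT_0 as HPI.
  pose proof (Cmod_ge_0 v) as Hr. pose proof (Cmod_sq v) as Hz.
  assert (Hv : v = (Re v, Im v)) by (destruct v; reflexivity).
  set (r := Cmod v) in *. set (a := Re v) in *. set (b := Im v) in *.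
  assert (Hr' : 0 < r) by nra.
  assert (Hsqrt : sqrt (1 + (b / a)²) = r / a).
  { replace (1 + (b / a)²) with ((r / a)²).
    - apply sqrt_Rsqr. apply Rdiv_le_0_compat; lra.
    - rewrite !Rsqr_div'. unfold Rsqr. rewrite Hz. field. lra. }
  rewrite Hv. unfold turn, e, Cmult, RtoC; simpl. fold a b.
  replace (2 * PI * (atan (b / a) / (2 * PI))) with (atan (b / a)) by (field; lra).
  rewrite cos_atan, sin_atan, Hsqrt. f_equal; field; lra.
Qed.

Lemma atan_abs_le (u : R) : Rabs (atan u) <= Rabs u.
Proof.
  destruct (MVT_abs atan (fun c => / (1 + c ^ 2)) 0 u) as [c [Hc _]].
  { intros c _. apply derivable_pt_lim_atan. }
  rewrite atan_0, !Rminus_0_r in Hc. rewrite Hc.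
  rewrite <- (Rmult_1_l (Rabs u)) at 2.
  apply Rmult_le_compat_r; [apply Rabs_pos|].
  pose proof (pow2_ge_0 c).
  rewrite Rabs_right by (apply Rle_ge, Rlt_le, Rinv_0_lt_compat; lra).
  rewrite <- Rinv_1. apply Rinv_le_contravar; lra.
Qed.

Lemma turn_small (v : C) : 0 < Re v -> Rabs (turn v) <= Rabs (Im v) / Re v.
Proof.
  intros Ha. pose proof PI_RGT_0 as HPI. pose proof PI2_1.
  unfold turn. unfold Rdiv at 1. rewrite Rabs_mult.
  assert (Hinv : 0 < / (2 * PI)) by (apply Rinv_0_lt_compat; lra).
  rewrite (Rabs_right (/ (2 * PI))) by lra.
  assert (/ (2 * PI) <= 1) by (rewrite <- Rinv_1; apply Rinv_le_contravar; lra).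
  pose proof (atan_abs_le (Im v / Re v)) as Hat.
  unfold Rdiv at 2 in Hat. rewrite Rabs_mult, Rabs_inv in Hat.
  rewrite (Rabs_right (Re v)) in Hat by lra.
  pose proof (Rabs_pos (atan (Im v / Re v))).
  unfold Rdiv at 2. nra.
Qed.

(** * Radial drift over a block *)

(** The supremum over one period controls every real angle, by periodicity. *)
Lemma radial_limit_uniform (phi : R) (f : C -> C) (Phi : R -> R) (eps : R) :
  periodic1 Phi -> radial_limit phi f Phi -> 0 < eps ->
  exists R0 : R, forall rho theta : R, R0 <= rho ->
    Rabs (Phi theta -
      Re (Cmult (Cconj (f (Cmult (RtoC rho) (e theta)))) (e (phi + theta)))) <= eps.
Proof.
  intros Hper [[R1 Hfin] Hlim] Heps.
  apply is_lim_spec in Hlim.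
  destruct (Hlim (mkposreal eps Heps)) as [R2 HR2]. simpl in HR2.
  exists (Rmax R1 R2 + 1). intros rho theta Hrho.
  pose proof (Rmax_l R1 R2). pose proof (Rmax_r R1 R2).
  specialize (Hfin rho ltac:(lra)). specialize (HR2 rho ltac:(lra)).
  destruct (floor_exists theta) as [z Hz].
  rewrite <- (periodic1_Z Phi (- z) theta Hper), <- (e_Z theta (- z)),
    <- (e_Z (phi + theta) (- z)), Rplus_assoc.
  rewrite Rminus_0_r in HR2. apply Rabs_def2 in HR2.
  apply Rle_trans with (real (radial_error phi f Phi rho)); [|lra].
  set (th := theta + IZR (- z)).
  assert (Hth : 0 <= th < 1) by (unfold th; rewrite opp_IZR; lra).
  unfold radial_error, sup_unit in *.
  match type of Hfin with is_finite (Lub_Rbar ?E) =>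
    destruct (Lub_Rbar_correct E) as [Hub _] end.
  rewrite <- Hfin in Hub.
  apply (Hub (Rabs (Phi th -
      Re (Cmult (Cconj (f (Cmult (RtoC rho) (e th)))) (e (phi + th)))))).
  exists th. split; [assumption | reflexivity].
Qed.

(** Here [beta] is the angle the point would have under pure rotation and
    [delta] its actual deviation: [Phi] describes the force at [beta + delta],
    whereas the radial motion is measured along [beta + phi].  Replacing one
    direction by the other costs [M |e(delta) - 1|]. *)
Lemma radial_increment_le (phi beta delta rho eps M kappa : R) (f : C -> C) (Phi : R -> R) (x : C) :
  x = Cmult (RtoC rho) (e (beta + delta)) ->
  Cmod (f x) <= M ->
  Cmod (Cminus (e delta) (RtoC 1)) <= kappa ->
  Rabs (Phi (beta + delta) -
      Re (Cmult (Cconj (f (Cmult (RtoC rho) (e (beta + delta)))))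
         (e (phi + (beta + delta))))) <= eps ->
  Re (Cmult (e (- (beta + phi))) (f x)) <= Phi (beta + delta) + eps + M * kappa.
Proof.
  intros Hx HM Hkappa Heps. rewrite <- Hx in Heps.
  assert (Hre : Re (Cmult (e (- (beta + phi))) (f x))
    = Re (Cmult (Cconj (f x)) (e (beta + phi)))).
  { rewrite e_opp. unfold Re, Cmult, Cconj; simpl. ring. }
  assert (Hdiff : Cmult (Cconj (f x)) (e (beta + phi))
    = Cplus (Cmult (Cconj (f x)) (e (phi + (beta + delta))))
        (Copp (Cmult (Cmult (Cconj (f x)) (e (beta + phi))) (Cminus (e delta) (RtoC 1))))).
  { replace (phi + (beta + delta)) with ((beta + phi) + delta) by ring.
    rewrite (e_plus (beta + phi) delta). ring. }
  rewrite Hre, Hdiff.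
  set (w := Copp (Cmult (Cmult (Cconj (f x)) (e (beta + phi))) (Cminus (e delta) (RtoC 1)))).
  assert (Hw : Re w <= M * kappa).
  { apply Rle_trans with (1 := Re_le_Cmod w). unfold w.
    rewrite Cmod_opp, !Cmod_mult, Cmod_conj, Cmod_e, Rmult_1_r.
    apply Rmult_le_compat; auto using Cmod_ge_0. }
  apply Rabs_le_between in Heps.
  change (Re (Cmult (Cconj (f x)) (e (phi + (beta + delta)))) + Re w
    <= Phi (beta + delta) + eps + M * kappa). lra.
Qed.
Lemma rotating_frame_step (phi alpha : R) (f : C -> C) (y x : nat -> C) (n i : nat) :
  is_solution phi f y x -> (1 <= n)%nat ->
  Cmult (e (- (alpha + INR (S i) * phi))) (x (n + S i)%nat) =
  Cplus (Cmult (e (- (alpha + INR i * phi))) (x (n + i)%nat))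
    (Cplus (Cmult (e (- (alpha + INR i * phi + phi))) (f (x (n + i)%nat)))
           (Cmult (e (- (alpha + INR i * phi + phi))) (y (n + i)%nat))).
Proof.
  intros Hsol Hn.
  rewrite Nat.add_succ_r, (Hsol (n + i)%nat) by lia.
  assert (He : Cmult (e (- (alpha + INR i * phi + phi))) (e phi)
    = e (- (alpha + INR i * phi))) by (rewrite <- e_plus; f_equal; ring).
  replace (- (alpha + INR (S i) * phi)) with (- (alpha + INR i * phi + phi))
    by (rewrite S_INR; ring).
  rewrite <- He. ring.
Qed.

(** In the frame [v i = e(-(alpha + i phi)) x(n + i)] the block starts at the real
    point [r = |x(n)|] and stays within [L = q (M + My)] of it.  Once [r] is large
    compared with [L] all the angles [turn (v i)] are below [eta], and the real part
    of [v] accumulates the drift. *)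
Lemma block_drift (phi : R) (f : C -> C) (y : nat -> C) (Phi : R -> R)
    (M My eta A eps : R) (q : nat) :
  (forall z, Cmod (f z) <= M) -> (forall k, (1 <= k)%nat -> Cmod (y k) <= My) ->
  periodic1 Phi -> radial_limit phi f Phi -> 0 < eta -> 0 < eps ->
  (forall (theta : R) (delta : nat -> R),
    (forall i, (i < q)%nat -> Rabs (delta i) <= eta) ->
    Rsum (fun i => Phi (theta + INR i * phi + delta i)) (seq 0 q) <= INR q * A) ->
  exists R0 : R, forall (x : nat -> C) (n : nat),
    is_solution phi f y x -> (1 <= n)%nat -> R0 <= Cmod (x n) ->
    Cmod (x (n + q)%nat) <= Cmod (x n) + INR q * (A + 2 * eps)
      + Cmod (sum_n_m (fun k => Cmult (y k) (e (- INR k * phi))) n (n + q - 1)) + eps.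
Proof.
  intros HM HMy Hper Hlim Heta Heps Havg.
  destruct (radial_limit_uniform phi f Phi eps Hper Hlim Heps) as [R1 HR1].
  assert (HM0 : 0 <= M) by (apply Rle_trans with (2 := HM 0); apply Cmod_ge_0).
  assert (HMy0 : 0 <= My)
    by (apply Rle_trans with (2 := HMy 1%nat (le_n _)); apply Cmod_ge_0).
  set (L := INR q * (M + My)).
  assert (HL : 0 <= L) by (apply Rmult_le_pos; [apply pos_INR | lra]).
  assert (HLeta : 0 <= 2 * L / eta) by (apply Rdiv_le_0_compat; lra).
  assert (HLM : 0 <= 4 * L * M / eps) by (apply Rdiv_le_0_compat; nra).
  assert (HLL : 0 <= L * L / eps) by (apply Rdiv_le_0_compat; nra).
  (* In turn, these terms ensure [Re (v i) >= r / 2], [|turn (v i)| <= eta],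
     [M |e (turn (v i)) - 1| <= eps], a second order loss at most [eps], and
     [|v i| >= R1]. *)
  exists (2 * L + 2 * L / eta + 4 * L * M / eps + L * L / eps + 2 * Rabs R1 + 1).
  intros x n Hsol Hn Hr.
  destruct (polar_form (x n)) as [alpha Halpha].
  set (r := Cmod (x n)) in *.
  pose proof (Rabs_pos R1). pose proof (Rle_abs R1).
  assert (Hr2L : 2 * L < r) by lra.
  assert (HrR1 : R1 <= r / 2) by lra.
  assert (Hreta : 2 * L <= r * eta).
  { replace (2 * L) with (2 * L / eta * eta) by (field; lra). nra. }
  assert (HrM : 4 * L * M <= r * eps).
  { replace (4 * L * M) with (4 * L * M / eps * eps) by (field; lra). nra. }
  assert (HrL : L * L <= r * eps).
  { replace (L * L) with (L * L / eps * eps) by (field; lra). nra. }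
  clear Hr HLeta HLM HLL.
  set (v := fun i : nat => Cmult (e (- (alpha + INR i * phi))) (x (n + i)%nat)).
  assert (Hv0 : v O = RtoC r).
  { unfold v. rewrite Nat.add_0_r, Halpha.
    replace (- (alpha + INR 0 * phi)) with (- alpha) by (simpl; ring).
    replace (Cmult (e (- alpha)) (Cmult (RtoC r) (e alpha)))
      with (Cmult (RtoC r) (Cmult (e (- alpha)) (e alpha))) by ring.
    rewrite e_opp_mult. ring. }
  assert (Hmod : forall i, Cmod (v i) = Cmod (x (n + i)%nat)).
  { intros i. unfold v. rewrite Cmod_mult, Cmod_e. ring. }
  assert (Hdist : forall i, Cmod (Cminus (v i) (RtoC r)) <= INR i * (M + My)).
  { induction i as [|i IHi].
    - rewrite Hv0. replace (Cminus (RtoC r) (RtoC r)) with (RtoC 0) by ring.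
      rewrite Cmod_0. simpl. lra.
    - unfold v. rewrite (rotating_frame_step phi alpha f y x n i Hsol Hn). fold (v i).
      set (F := Cmult _ (f _)). set (Y := Cmult _ (y _)).
      assert (HF : Cmod F <= M) by (unfold F; rewrite Cmod_mult, Cmod_e, Rmult_1_l; apply HM).
      assert (HY : Cmod Y <= My)
        by (unfold Y; rewrite Cmod_mult, Cmod_e, Rmult_1_l; apply HMy; lia).
      replace (Cminus (Cplus (v i) (Cplus F Y)) (RtoC r))
        with (Cplus (Cminus (v i) (RtoC r)) (Cplus F Y)) by ring.
      pose proof (Cmod_triangle (Cminus (v i) (RtoC r)) (Cplus F Y)).
      pose proof (Cmod_triangle F Y).
      rewrite S_INR. lra. }
  assert (HdistL : forall i, (i <= q)%nat -> Cmod (Cminus (v i) (RtoC r)) <= L).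
  { intros i Hi. apply Rle_trans with (1 := Hdist i). unfold L.
    apply Rmult_le_compat_r; [lra | apply le_INR; assumption]. }
  assert (Hre : forall i, (i <= q)%nat -> r / 2 <= Re (v i)).
  { intros i Hi. pose proof (re_le_Cmod (Cminus (v i) (RtoC r))) as Hc.
    specialize (HdistL i Hi).
    assert (Hsub : Re (Cminus (v i) (RtoC r)) = Re (v i) - r) by reflexivity.
    rewrite Hsub in Hc. apply Rabs_le_between in Hc. lra. }
  assert (Him : forall i, (i <= q)%nat -> Rabs (Im (v i)) <= L).
  { intros i Hi. pose proof (Im_le_Cmod (Cminus (v i) (RtoC r))) as Hc.
    specialize (HdistL i Hi).
    assert (Hsub : Im (Cminus (v i) (RtoC r)) = Im (v i) - 0) by reflexivity.
    rewrite Hsub, Rminus_0_r in Hc. lra. }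
  assert (Hturn : forall i, (i < q)%nat -> Rabs (turn (v i)) <= eta).
  { intros i Hi. specialize (Hre i ltac:(lia)). specialize (Him i ltac:(lia)).
    apply Rle_trans with (1 := turn_small (v i) ltac:(lra)).
    apply Rle_div_l; nra. }
  assert (Hpolar : forall i, (i < q)%nat ->
    x (n + i)%nat
      = Cmult (RtoC (Cmod (v i))) (e (alpha + INR i * phi + turn (v i)))).
  { intros i Hi. specialize (Hre i ltac:(lia)).
    rewrite e_plus.
    replace (Cmult (RtoC (Cmod (v i))) (Cmult (e (alpha + INR i * phi)) (e (turn (v i)))))
      with (Cmult (e (alpha + INR i * phi)) (Cmult (RtoC (Cmod (v i))) (e (turn (v i)))))
      by ring.
    rewrite <- turn_polar by lra. unfold v.
    rewrite Cmult_assoc, (Cmult_comm (e (alpha + _))), e_opp_mult. ring. }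
  (* [rho (e (turn (v i)) - 1) = v i - rho], and both [v i] and [rho] are within
     [L] of [r]. *)
  assert (Hkappa : forall i, (i < q)%nat ->
    Cmod (Cminus (e (turn (v i))) (RtoC 1)) <= 4 * L / r).
  { intros i Hi. specialize (Hre i ltac:(lia)). specialize (HdistL i ltac:(lia)).
    pose proof (turn_polar (v i) ltac:(lra)) as Hp.
    pose proof (Re_le_Cmod (v i)).
    set (rho := Cmod (v i)) in *. set (t := turn (v i)) in *.
    assert (Hrho : Rabs (rho - r) <= L).
    { apply Rle_trans with (2 := HdistL).
      pose proof (Cmod_triangle (Cminus (v i) (RtoC r)) (RtoC r)) as T1.
      pose proof (Cmod_triangle (Cminus (RtoC r) (v i)) (v i)) as T2.
      replace (Cplus (Cminus (v i) (RtoC r)) (RtoC r)) with (v i) in T1 by ring.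
      replace (Cplus (Cminus (RtoC r) (v i)) (v i)) with (RtoC r) in T2 by ring.
      replace (Cminus (RtoC r) (v i)) with (Copp (Cminus (v i) (RtoC r))) in T2 by ring.
      rewrite Cmod_opp in T2. rewrite Cmod_R, Rabs_right in T1, T2 by lra.
      fold rho in T1, T2. apply Rabs_le. lra. }
    assert (Hscaled : Cmod (Cmult (RtoC rho) (Cminus (e (t)) (RtoC 1))) <= 2 * L).
    { replace (Cmult (RtoC rho) (Cminus (e (t)) (RtoC 1)))
        with (Cplus (Cminus (v i) (RtoC r)) (RtoC (r - rho)))
        by (rewrite RtoC_minus, Hp; ring).
      apply Rle_trans with (1 := Cmod_triangle _ _).
      rewrite Cmod_R, <- Rabs_Ropp, Ropp_minus_distr. lra. }
    rewrite Cmod_mult, Cmod_R, Rabs_right in Hscaled by lra.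
    pose proof (Cmod_ge_0 (Cminus (e t) (RtoC 1))).
    apply Rle_div_r; nra. }
  (* The unimodular [w] turns the sum of the [y]-terms, seen in the frame of the
     block, into the sum that occurs in the drift hypothesis. *)
  set (z := fun k => Cmult (y k) (e (- INR k * phi))).
  set (w := e (- (alpha + phi - INR n * phi))).
  assert (Hdrift : forall j, (j <= q)%nat -> Re (v j) <= r
     + Rsum (fun i => Phi (alpha + INR i * phi + turn (v i))) (seq 0 j)
     + INR j * (2 * eps) + Re (Cmult w (sum_n_m z n (n + j - 1)))).
  { induction j as [|j IHj]; intros Hj.
    - rewrite Hv0, sum_n_m_zero by lia. unfold Rsum, zero; simpl. lra.
    - specialize (IHj ltac:(lia)).
      replace (n + S j - 1)%nat with (S (n + j - 1))%nat by lia.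
      rewrite sum_n_Sm by lia. replace (S (n + j - 1)) with (n + j)%nat by lia.
      rewrite Rsum_seq_S, S_INR.
      assert (HF : Re (Cmult (e (- (alpha + INR j * phi + phi))) (f (x (n + j)%nat)))
        <= Phi (alpha + INR j * phi + turn (v j)) + 2 * eps).
      { specialize (Hre j ltac:(lia)). pose proof (Re_le_Cmod (v j)).
        pose proof (radial_increment_le phi (alpha + INR j * phi) (turn (v j))
          (Cmod (v j)) eps M (4 * L / r) f Phi (x (n + j)%nat)
          (Hpolar j ltac:(lia)) (HM _) (Hkappa j ltac:(lia))
          (HR1 (Cmod (v j)) _ ltac:(lra))) as Hinc.
        assert (M * (4 * L / r) <= eps).
        { replace (M * (4 * L / r)) with (4 * L * M / r) by (field; lra).
          apply Rle_div_l; lra. }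
        lra. }
      assert (HY : Cmult (e (- (alpha + INR j * phi + phi))) (y (n + j)%nat)
        = Cmult w (z (n + j)%nat)).
      { unfold w, z.
        replace (- (alpha + INR j * phi + phi))
          with (- (alpha + phi - INR n * phi) + - INR (n + j) * phi)
          by (rewrite plus_INR; ring).
        rewrite e_plus. ring. }
      assert (Hvs : Re (v (S j)) = Re (v j)
        + (Re (Cmult (e (- (alpha + INR j * phi + phi))) (f (x (n + j)%nat)))
           + Re (Cmult w (z (n + j)%nat)))).
      { unfold v at 1. rewrite (rotating_frame_step phi alpha f y x n j Hsol Hn).
        rewrite HY. reflexivity. }
      assert (Hws : Re (Cmult w (plus (sum_n_m z n (n + j - 1)) (z (n + j)%nat)))
        = Re (Cmult w (sum_n_m z n (n + j - 1))) + Re (Cmult w (z (n + j)%nat))).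
      { change (plus (sum_n_m z n (n + j - 1)) (z (n + j)%nat))
          with (Cplus (sum_n_m z n (n + j - 1)) (z (n + j)%nat)).
        rewrite Cmult_plus_distr_l. reflexivity. }
      rewrite Hvs, Hws. lra. }
  specialize (Hdrift q (le_n q)). specialize (Havg alpha (fun i => turn (v i)) Hturn).
  cbv beta in Havg.
  pose proof (Re_le_Cmod (Cmult w (sum_n_m z n (n + q - 1)))) as HW.
  rewrite Cmod_mult in HW. unfold w in HW at 2. rewrite Cmod_e, Rmult_1_l in HW.
  specialize (Hre q (le_n q)). specialize (Him q (le_n q)).
  pose proof (Cmod_le_Re_plus (v q) ltac:(lra)) as Hmv.
  assert (Hquad : Im (v q) * Im (v q) / (2 * Re (v q)) <= eps).
  { apply Rle_div_l; [lra|]. apply Rabs_le_between in Him. nra. }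
  rewrite <- Hmod. lra.
Qed.

(** Comparing [n] with [n - q]: if [|x(n - q)|] is at least [R0] the modulus has not
    grown over the block, and otherwise bounded steps keep [|x(n)|] below
    [R0 + q K]. *)
Lemma bounded_of_block_decrease (x : nat -> C) (q : nat) (K R0 : R) :
  (0 < q)%nat -> 0 <= K ->
  (forall n, (1 <= n)%nat -> Cmod (x (S n)) <= Cmod (x n) + K) ->
  (forall n, (1 <= n)%nat -> R0 <= Cmod (x n) -> Cmod (x (n + q)%nat) <= Cmod (x n)) ->
  bounded_seq x.
Proof.
  intros Hq HK Hstep Hblock.
  assert (Hgrow : forall n i, (1 <= n)%nat -> Cmod (x (n + i)%nat) <= Cmod (x n) + INR i * K).
  { intros n i Hn. induction i as [|i IHi].
    - rewrite Nat.add_0_r. simpl. lra.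
    - rewrite Nat.add_succ_r, S_INR. specialize (Hstep (n + i)%nat ltac:(lia)). lra. }
  exists (Rmax (Cmod (x 1%nat)) R0 + INR q * K).
  intros n. induction n as [n IH] using (well_founded_induction lt_wf). intros Hn.
  pose proof (Rmax_l (Cmod (x 1%nat)) R0). pose proof (Rmax_r (Cmod (x 1%nat)) R0).
  destruct (le_lt_dec n q) as [Hnq | Hnq].
  - specialize (Hgrow 1%nat (n - 1)%nat (le_n _)).
    replace (1 + (n - 1))%nat with n in Hgrow by lia.
    assert (INR (n - 1) <= INR q) by (apply le_INR; lia). nra.
  - specialize (Hgrow (n - q)%nat q ltac:(lia)).
    specialize (Hblock (n - q)%nat ltac:(lia)).
    specialize (IH (n - q)%nat ltac:(lia) ltac:(lia)).
    replace (n - q + q)%nat with n in Hgrow, Hblock by lia.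
    destruct (Rle_lt_dec R0 (Cmod (x (n - q)%nat))) as [Hbig | Hsmall].
    + specialize (Hblock Hbig). lra.
    + lra.
Qed.

Theorem theorem1p1 (phi : R) (f : C -> C) (y : nat -> C) (Phi : R -> R)
  (phi_range : 0 <= phi < 1)
  (phi_irrational : irrational phi)
  (f_bounded : bounded_fun f)
  (y_bounded : bounded_seq y)
  (Phi_periodic : periodic1 Phi)
  (Phi_limit : radial_limit phi f Phi)
  (Phi_integrable : ex_RInt Phi 0 1)
  (negative_drift : exists (D0 : nat) (beta : R), beta < 0 /\
     forall n1 n2 : nat, (1 <= n1)%nat -> (n1 < n2)%nat -> (D0 <= n2 - n1)%nat ->
       / INR (n2 - n1) *
         Cmod (sum_n_m (fun n => Cmult (y n) (e (- INR n * phi))) n1 (n2 - 1))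
       + RInt Phi 0 1 <= beta) :
  forall (x1 : C) (x : nat -> C),
    x 1%nat = x1 -> is_solution phi f y x -> bounded_seq x.
Proof.
  intros x1 x _ Hsol.
  destruct f_bounded as [M HM]. destruct y_bounded as [My HMy].
  destruct negative_drift as (D0 & beta & Hbeta & Hdrift).
  (* A block loses [- q beta = 4 q eps]; the errors are [eps] per step from the
     average, [2 eps] per step from the force, and [eps] once. *)
  set (eps := - beta / 4). assert (Heps : 0 < eps) by (unfold eps; lra).
  destruct (rotation_average phi Phi eps D0 phi_range phi_irrational Phi_periodic
    Phi_integrable Heps) as (q & HqD & Hq & eta & Heta & Havg).
  destruct (block_drift phi f y Phi M My eta (RInt Phi 0 1 + eps) eps q HM HMy
    Phi_periodic Phi_limit Heta Heps Havg) as [R0 HR0].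
  assert (HM0 : 0 <= M) by (apply Rle_trans with (2 := HM 0); apply Cmod_ge_0).
  assert (HMy0 : 0 <= My)
    by (apply Rle_trans with (2 := HMy 1%nat (le_n _)); apply Cmod_ge_0).
  apply (bounded_of_block_decrease x q (M + My) R0); [assumption | lra | |].
  - intros n Hn. rewrite (Hsol n Hn).
    pose proof (Cmod_triangle (Cplus (Cmult (e phi) (x n)) (f (x n))) (y n)).
    pose proof (Cmod_triangle (Cmult (e phi) (x n)) (f (x n))) as H2.
    rewrite Cmod_mult, Cmod_e in H2.
    specialize (HM (x n)). specialize (HMy n Hn). lra.
  - intros n Hn Hbig. specialize (HR0 x n Hsol Hn Hbig).
    specialize (Hdrift n (n + q)%nat Hn ltac:(lia) ltac:(lia)).
    replace (n + q - n)%nat with q in Hdrift by lia.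
    set (S := Cmod (sum_n_m _ n (n + q - 1))) in *.
    assert (Hq1 : 1 <= INR q) by (apply (le_INR 1); assumption).
    apply Rmult_le_compat_l with (r := INR q) in Hdrift; [|lra].
    rewrite Rmult_plus_distr_l, <- Rmult_assoc, Rinv_r, Rmult_1_l in Hdrift by lra.
    assert (beta = - (4 * eps)) by (unfold eps; field).
    nra.
Qed.
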